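(* Let $A$ be a complete discrete valuation ring in which $2$ is a unit, with maximal ideal $\mathfrak r$, an involution $*$, and a fixed uniformiser $y$, where $y^*=-y$ if $*$ is nontrivial. Let $V$ be a free $A$-module of finite rank $m>0$, let $\varepsilon\in\{1,-1\}$, and let $h$ and $h'$ be $\varepsilon$-hermitian forms on $V$ (possibly degenerate). If, for each nonnegative integer $i$, the forms $h_i$ and $h'_i$ over $A/\mathfrak r$ associated with $h$ and $h'$ are equivalent, then $h$ and $h'$ are equivalent.
   Context: An involution of $A$ is a ring automorphism $a\mapsto a^*$ of order at most two (the identity is allowed, and is called trivial); it induces an involution, also denoted $*$, on $A/\mathfrak r$. A uniformiser is a generator of $\mathfrak r$; if $*$ is nontrivial, a uniformiser with $y^*=-y$ always exists. Complete means that $\bigcap_{i\ge1}\mathfrak r^i=0$ and $A$ is complete for its $\mathfrak r$-adic metric. A map $h:V\times V\to A$ is an $\varepsilon$-hermitian form if it is bi-additive, $A$-linear in the second variable, and $h(v,u)=\varepsilon h(u,v)^*$ for all $u,v$. Given such an $h$, set $V(-1)=0$ and $V(i)=\{v\in V: h(V,v)\subset\mathfrak r^i\}$ for $i\ge0$. Then $W(i)=V(i)/(\mathfrak rV(i-1)+V(i+1))$ is an $A/\mathfrak r$-vector space, and $h_i:W(i)\times W(i)\to A/\mathfrak r$ is the well-defined form given by $h_i(\tilde u,\tilde v)=y^{-i}h(u,v)+\mathfrak r$, where $\tilde u,\tilde v$ are the classes of $u,v\in V(i)$. ($h_i$ is $\varepsilon$-hermitian if $*$ is trivial and $(-1)^i\varepsilon$-hermitian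 if $*$ is nontrivial.) The form $h'_i$ is defined in the same way from $h'$, on the space $W'(i)$ built from $h'$. Two forms $h_1$ on $V_1$ and $h_2$ on $V_2$ (over the same ring) are equivalent if there is a linear isomorphism $\varphi:V_1\to V_2$ with $h_1(u,v)=h_2(\varphi(u),\varphi(v))$ for all $u,v\in V_1$. *)

(* Defs.v *)
From HB Require Import structures.
From mathcomp Require Import all_boot all_order all_algebra.
From mathcomp Require Import boolp classical_sets.

Set Implicit Arguments.
Unset Strict Implicit.
Unset Printing Implicit Defensive.
Import GRing.Theory.
Local Open Scope ring_scope.
Local Open Scope quotient_scope.

Definition is_ideal (R : comNzRingType) (I : set R) : Prop :=
  [/\ I 0, forall x y, I x -> I y -> I (x + y) & forall a x, I x -> I (a * x)].

Definition principal (R : comNzRingType) (a : R) : set R :=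
  [set x | exists b, x = a * b].

Definition maximal_ideal (R : comNzRingType) (M : set R) : Prop :=
  [/\ is_ideal M, ~ M 1 &
      forall I : set R, is_ideal I -> ~ I 1 -> subset M I -> I = M].

(* I N, the additive span of the products a *: v with a in I and v in N. *)
Definition ideal_smul (R : comNzRingType) (V : lmodType R)
    (I : set R) (N : set V) : set V :=
  [set v | exists2 s : seq (R * V),
     (forall p, p \in s -> I p.1 /\ N p.2) & v = \sum_(p <- s) p.1 *: p.2].

Fixpoint ideal_pow (R : comNzRingType) (I : set R) (n : nat) : set R :=
  if n is n'.+1 then ideal_smul (V := R^o) I (ideal_pow I n') else setT.

(* A discrete valuation ring is a local principal ideal domain which is not a
   field; being local is stated as "the sum of two nonunits is a nonunit", so that the
   nonunits form the unique maximal ideal (maximal_idealP below). *)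
HB.mixin Record IntegralDomain_isDVR A of GRing.IntegralDomain A := {
  dvr_principal : forall I : set A, is_ideal I -> exists a, I = principal a;
  dvr_local : forall a b : A, a \isn't a GRing.unit -> b \isn't a GRing.unit ->
    a + b \isn't a GRing.unit;
  dvr_not_field : exists2 a : A, a != 0 & a \isn't a GRing.unit
}.

#[short(type="dvrType")]
HB.structure Definition DVR :=
  {A of GRing.IntegralDomain A & IntegralDomain_isDVR A}.

Section MaximalIdeal.
Variable A : dvrType.

Definition maxideal : {pred A} := fun a => a \isn't a GRing.unit.

Definition rset : set A := [set a | a \in maxideal].

Lemma maxidealE a : (a \in maxideal) = (a \isn't a GRing.unit).
Proof. by []. Qed.

Lemma maxideal_closed : idealr_closed maxideal.
Proof.
split; rewrite ?maxidealE ?unitr0 ?unitr1 // => a u v.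
rewrite !maxidealE => uN vN; apply: dvr_local => //.
by rewrite unitrM negb_and uN orbT.
Qed.

HB.instance Definition _ := isIdealr.Build A maxideal maxideal_closed.

Lemma rset_ideal : is_ideal rset.
Proof.
by split=> [|x y|a x]; rewrite /rset /= ?rpred0 //; [exact: rpredD|exact: idealMr].
Qed.

Lemma maximal_idealP (M : set A) : maximal_ideal M <-> M = rset.
Proof.
have r1 : ~ rset 1 by rewrite /rset /= maxidealE unitr1.
have sub_r I : is_ideal I -> ~ I 1 -> subset I rset.
  move=> [_ _ IM] I1 x Ix; rewrite /rset /= maxidealE; apply/negP => xU.
  by apply: I1; rewrite -(mulVr xU); apply: IM.
split=> [[Mi M1 Mmax]|->].
  by rewrite -(Mmax _ rset_ideal r1 (sub_r _ Mi M1)).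
split=> // [|I Ii I1 rI]; first exact: rset_ideal.
by apply/seteqP; split=> //; apply: sub_r.
Qed.

Definition residue : Type := {ideal_quot maxideal}.

HB.instance Definition _ := GRing.ComNzRing.on residue.
HB.instance Definition _ := NzRingQuotient.on residue.

Lemma residue_eq0 (a : A) : (\pi_residue a == 0) = (a \in maxideal).
Proof.
have -> : 0 = \pi_residue 0 :> residue by rewrite (rmorph0 \pi_residue).
by rewrite -[RHS]/(a \in _) -{2}[a]subr0 Quotient.idealrBE.
Qed.

Definition residue_inv (x : residue) : residue :=
  if x == 0 then 0 else \pi_residue (repr x)^-1.

Lemma residue_mulVf (x : residue) : x != 0 -> residue_inv x * x = 1.
Proof.
move=> x0; rewrite /residue_inv (negPf x0) -{2}[x]reprK -rmorphM mulVr ?rmorph1 //.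
by rewrite -[x]reprK residue_eq0 maxidealE negbK in x0.
Qed.

Lemma residue_inv0 : residue_inv 0 = 0.
Proof. by rewrite /residue_inv eqxx. Qed.

HB.instance Definition _ :=
  GRing.ComNzRing_isField.Build residue residue_mulVf residue_inv0.

Definition uniformiser (y : A) : Prop := rset = principal y.

Definition radic_cauchy (u : nat -> A) : Prop := forall i, exists N,
  forall m n, (N <= m)%N -> (N <= n)%N -> ideal_pow rset i (u m - u n).

Definition radic_cvg (u : nat -> A) (l : A) : Prop := forall i, exists N,
  forall n, (N <= n)%N -> ideal_pow rset i (u n - l).

Definition complete_dvr : Prop :=
  (forall a, (forall i, (1 <= i)%N -> ideal_pow rset i a) -> a = 0) /\
  (forall u, radic_cauchy u -> exists l, radic_cvg u l).

(* y^{-i} x, the unique a with x = y^i a, when y != 0 and y^i divides x. *)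
Definition divpow (y : A) (i : nat) (x : A) : A :=
  xget 0 [set a | x = y ^+ i * a]%classic.

End MaximalIdeal.
Arguments residue : clear implicits.
Arguments rset : clear implicits.
Arguments complete_dvr : clear implicits.
Arguments maxideal : clear implicits.

Definition equivalent (R : nzRingType) (V1 V2 : lmodType R)
    (h1 : V1 -> V1 -> R) (h2 : V2 -> V2 -> R) : Prop :=
  exists2 phi : {linear V1 -> V2}, bijective phi &
    forall u v, h1 u v = h2 (phi u) (phi v).

Record herm_form (A : dvrType) (star : involutive_rmorphism A) (eps : A)
    (V : lmodType A) := HermForm {
  herm_fun :> V -> V -> A;
  herm_addl : forall u v w, herm_fun (u + v) w = herm_fun u w + herm_fun v w;
  herm_addr : forall u v w, herm_fun u (v + w) = herm_fun u v + herm_fun u w;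
  herm_scaler : forall a u v, herm_fun u (a *: v) = a * herm_fun u v;
  herm_sym : forall u v, herm_fun v u = eps * star (herm_fun u v)
}.

Section IdealLemmas.
Variable A : dvrType.
Implicit Types (V : lmodType A) (a : A).

Lemma smulD V I (N : set V) u v :
  ideal_smul I N u -> ideal_smul I N v -> ideal_smul I N (u + v).
Proof.
move=> [s sP ->] [t tP ->]; exists (s ++ t); last by rewrite big_cat.
by move=> p; rewrite mem_cat => /orP[/sP|/tP].
Qed.

Lemma smul0 V I (N : set V) : ideal_smul I N 0.
Proof. by exists [::]; rewrite ?big_nil. Qed.

Lemma smulM V (I : set A) (N : set V) a v : I a -> N v -> ideal_smul I N (a *: v).
Proof.
by move=> Ia Nv; exists [:: (a, v)]; rewrite ?big_seq1 // => p /[!inE] /eqP->.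
Qed.

Lemma smul_ind V (I : set A) (N P : set V) :
    P 0 -> (forall u v, P u -> P v -> P (u + v)) ->
    (forall a v, I a -> N v -> P (a *: v)) ->
  forall v, ideal_smul I N v -> P v.
Proof.
move=> P0 PD PM v [s sP ->]; rewrite big_seq; apply: big_ind => // p /sP[].
exact: PM.
Qed.

Lemma smulZ V (I : set A) (N : set V) a v :
  is_ideal I -> ideal_smul I N v -> ideal_smul I N (a *: v).
Proof.
move=> [_ _ IM]; move: v; apply: smul_ind => [|u v ? ?|b v Ib Nv].
- by rewrite scaler0; apply: smul0.
- by rewrite scalerDr; apply: smulD.
- by rewrite scalerA; apply: smulM => //; apply: IM.
Qed.

Lemma pow_ideal i : is_ideal (ideal_pow (rset A) i).
Proof.
case: i => [//|i] /=; split; first exact: smul0.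
  by move=> *; apply: smulD.
by move=> a x; apply: (smulZ (V := A^o)); apply: rset_ideal.
Qed.

Lemma powM i a x : rset A a -> ideal_pow (rset A) i x -> ideal_pow (rset A) i.+1 (a * x).
Proof. exact: (smulM (V := A^o)). Qed.

Lemma pow_star (star : involutive_rmorphism A) i x :
  ideal_pow (rset A) i x -> ideal_pow (rset A) i (star x).
Proof.
elim: i x => [//|i IH] /=.
apply: (smul_ind (V := A^o)) => [|u v ? ?|a v Ia Nv].
- by rewrite rmorph0; apply: smul0.
- by rewrite rmorphD; apply: (smulD (V := A^o)).
- rewrite [a *: v]/(a * v) rmorphM; apply: powM; last exact: IH.
  have starK : involutive star by exact: involutive_subproof.
  move: Ia; rewrite /rset /= !maxidealE; apply: contra => aU.
  by rewrite -[a]starK; apply: (rmorph_unit star).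
Qed.

Lemma pow_uniformiser y i x :
  uniformiser y -> ideal_pow (rset A) i x -> exists a, x = y ^+ i * a.
Proof.
move=> yP; elim: i x => [|i IH] x; first by exists x; rewrite expr0 mul1r.
rewrite /=; move: x; apply: (smul_ind (V := A^o)) => [|u v [b ->] [c ->]|a v].
- by exists 0; rewrite mulr0.
- by exists (b + c); rewrite mulrDr.
- move=> ra /IH[c ->]; have [b ->] : principal y a by rewrite -yP.
  exists (b * c).
  by rewrite [_ *: _]/(_ * _) exprS mulrACA.
Qed.

Lemma uniformiser_neq0 (y : A) : uniformiser y -> y != 0.
Proof.
move=> yP; apply/eqP => y0; have [a a0 aN] := dvr_not_field (s := A).
have : rset A a by [].
by rewrite yP y0 => -[b]; rewrite mul0r => /eqP; rewrite (negPf a0).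
Qed.

Lemma pow_uniformiserV y i a : uniformiser y -> ideal_pow (rset A) i (y ^+ i * a).
Proof.
move=> yP; elim: i => [//|i IH]; rewrite exprS -mulrA; apply: powM => //.
by have -> := yP; exists 1; rewrite mulr1.
Qed.

Lemma divpowE y i a : y != 0 -> divpow y i (y ^+ i * a) = a.
Proof.
move=> y0; rewrite /divpow; case: xgetP => [b _ /= yab|/(_ a)[]//].
by apply/esym/(mulfI _ yab); rewrite expf_neq0.
Qed.

Lemma divpow_pi y i x1 x2 : uniformiser y ->
    ideal_pow (rset A) i x1 -> ideal_pow (rset A) i.+1 (x1 - x2) ->
  \pi_(residue A) (divpow y i x1) = \pi_(residue A) (divpow y i x2).
Proof.
move=> yP /(pow_uniformiser yP)[a ->] /(pow_uniformiser yP)[b xE].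
have y0 := uniformiser_neq0 yP.
have -> : x2 = y ^+ i * (a - y * b).
  by rewrite mulrBr mulrA -exprSr -xE opprB addrC subrK.
rewrite !divpowE //; apply/eqP; rewrite -Quotient.idealrBE opprB addrC subrK.
by have : rset A (y * b) by rewrite yP; exists b.
Qed.

End IdealLemmas.

Section Layers.
Variables (A : dvrType) (star : involutive_rmorphism A) (eps : A).
Variables (V : lmodType A) (h : herm_form star eps V).

Definition Vlayer (i : nat) : {pred V} :=
  fun v => `[< forall u, ideal_pow (rset A) i (h u v) >].

(* Vprev i is V(i - 1), with V(-1) = 0. *)
Definition Vprev (i : nat) : set V :=
  if i is j.+1 then [set v | v \in Vlayer j] else [set 0]%classic.

(* r V(i - 1) + V(i + 1) *)
Definition Vnull (i : nat) : set V :=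
  [set v | exists a b, [/\ ideal_smul (rset A) (Vprev i) a, b \in Vlayer i.+1
                         & v = a + b]].

Lemma VlayerP i v :
  reflect (forall u, ideal_pow (rset A) i (h u v)) (v \in Vlayer i).
Proof. exact: asboolP. Qed.

Lemma Vlayer_closed i : submod_closed (Vlayer i).
Proof.
have [P0 PD PM] := pow_ideal A i.
split=> [|a u v /VlayerP uP /VlayerP vP]; apply/VlayerP => w.
  by rewrite -(scale0r 0) herm_scaler mul0r.
by rewrite herm_addr herm_scaler; apply: PD; first apply: PM.
Qed.

HB.instance Definition _ i :=
  GRing.isSubmodClosed.Build A V (Vlayer i) (Vlayer_closed i).

Definition Vsub (i : nat) : Type := {v : V | v \in Vlayer i}.

HB.instance Definition _ i := SubChoice.on (Vsub i).
HB.instance Definition _ i := [SubChoice_isSubLmodule of Vsub i by <:].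

Definition Wker (i : nat) : {pred Vsub i} := fun v => `[< Vnull i (\val v) >].

Arguments Wker : clear implicits.

Lemma Vnull0 i : Vnull i 0.
Proof. by exists 0, 0; split; [exact: smul0|exact: rpred0|rewrite addr0]. Qed.

Lemma VnullD i u v : Vnull i u -> Vnull i v -> Vnull i (u + v).
Proof.
move=> [a [b [aP bP ->]]] [c [d [cP dP ->]]]; exists (a + c), (b + d).
by split; [exact: smulD|exact: rpredD|rewrite addrACA].
Qed.

Lemma VnullZ i c v : Vnull i v -> Vnull i (c *: v).
Proof.
move=> [a [b [aP bP ->]]]; exists (c *: a), (c *: b).
by split; [apply: smulZ => //; exact: rset_ideal|exact: rpredZ|rewrite scalerDr].
Qed.

Lemma Wker_closed i : zmod_closed (Wker i).
Proof.
split=> [|u v /asboolP uP /asboolP vP]; apply/asboolP; first exact: Vnull0.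
by rewrite raddfB /= -scaleN1r; apply: VnullD => //; apply: VnullZ.
Qed.

HB.instance Definition _ i := GRing.isZmodClosed.Build _ (Wker i) (Wker_closed i).

Definition W (i : nat) : Type := {ideal_quot (Wker i)}.

HB.instance Definition _ i := GRing.Zmodule.on (W i).
HB.instance Definition _ i := ZmodQuotient.on (W i).

Lemma W_eq i (u v : Vsub i) :
  (\pi_(W i) u = \pi_(W i) v) <-> Vnull i (\val u - \val v).
Proof.
have <- : \val (u - v) = \val u - \val v by rewrite raddfB.
split=> [/eqP|uv]; first by rewrite -Quotient.idealrBE => /asboolP.
by apply/eqP; rewrite -Quotient.idealrBE; apply/asboolP.
Qed.

Lemma Vnull_rset i a (v : Vsub i) : a \in maxideal A -> Vnull i (a *: \val v).
Proof.
move=> ra; exists 0, (a *: \val v); split; rewrite ?add0r //; first exact: smul0.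
apply/VlayerP => u; rewrite herm_scaler; apply: powM => //.
by have /VlayerP := valP v.
Qed.

Definition W_scale i (a : residue A) (w : W i) : W i :=
  \pi_(W i) (repr a *: repr w).

Lemma W_scale_pi i (a : A) (v : Vsub i) :
  W_scale (\pi_(residue A) a) (\pi_(W i) v) = \pi_(W i) (a *: v).
Proof.
rewrite /W_scale; set b := repr _; set w := repr _.
have ba : b - a \in maxideal A by rewrite Quotient.idealrBE reprK.
have wv : Vnull i (\val w - \val v) by apply/W_eq; rewrite reprK.
apply/W_eq.
have -> : \val (b *: w) - \val (a *: v)
        = (b - a) *: \val w + a *: (\val w - \val v).
  by rewrite ![\val (_ *: _)]linearZ scalerBl scalerBr addrA subrK.
by apply: VnullD; [exact: Vnull_rset|exact: VnullZ].
Qed.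

Lemma W_scaleA i (a b : residue A) (w : W i) :
  W_scale a (W_scale b w) = W_scale (a * b) w.
Proof.
rewrite -[a]reprK -[b]reprK -[w]reprK -rmorphM.
by rewrite (W_scale_pi (repr b) (repr w)) !W_scale_pi scalerA.
Qed.

Lemma W_scale1 i : left_id 1 (@W_scale i).
Proof.
move=> w; have -> : 1 = \pi_(residue A) 1 by rewrite rmorph1.
by rewrite -[w]reprK W_scale_pi scale1r.
Qed.

Lemma W_scaleDr i : right_distributive (@W_scale i) +%R.
Proof.
move=> a u v; rewrite -[a]reprK -[u]reprK -[v]reprK.
by rewrite -raddfD !W_scale_pi -raddfD scalerDr.
Qed.

Lemma W_scaleDl i (w : W i) :
  {morph (@W_scale i)^~ w : a b / a + b >-> a + b}.
Proof.
move=> a b /=; rewrite -[a]reprK -[b]reprK -[w]reprK.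
by rewrite -raddfD !W_scale_pi -raddfD scalerDl.
Qed.

HB.instance Definition _ i := GRing.Zmodule_isLmodule.Build (residue A) (W i)
  (@W_scaleA i) (@W_scale1 i) (@W_scaleDr i) (@W_scaleDl i).

(* h_i, computed on chosen representatives; see hresE for independence. *)
Definition hres (y : A) (i : nat) (w1 w2 : W i) : residue A :=
  \pi_(residue A) (divpow y i (h (\val (repr w1)) (\val (repr w2)))).

Lemma pow_symm i u v : ideal_pow (rset A) i (h u v) -> ideal_pow (rset A) i (h v u).
Proof.
move=> huv; rewrite herm_sym; have [_ _ PM] := pow_ideal A i.
by apply: PM; apply: pow_star.
Qed.

Lemma herm_Vnull i u v :
  u \in Vlayer i -> Vnull i v -> ideal_pow (rset A) i.+1 (h u v).
Proof.
move=> uP [a [b [aP /VlayerP bP ->]]]; have [P0 PD PM] := pow_ideal A i.+1.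
rewrite herm_addr; apply: (PD) => //; move: a aP.
apply: smul_ind => [|c d ? ?|c d rc dP].
- by rewrite -(scale0r 0) herm_scaler mul0r.
- by rewrite herm_addr; apply: (PD).
rewrite herm_scaler; apply: powM => //; apply: pow_symm.
by have /VlayerP := uP.
Qed.

Lemma hresE y i (u v : Vsub i) : uniformiser y ->
  hres y (\pi_(W i) u) (\pi_(W i) v)
    = \pi_(residue A) (divpow y i (h (\val u) (\val v))).
Proof.
move=> yP; rewrite /hres; set u' := repr _; set v' := repr _.
have uu : Vnull i (\val u' - \val u) by apply/W_eq; rewrite reprK.
have vv : Vnull i (\val v' - \val v) by apply/W_eq; rewrite reprK.
apply: divpow_pi => //; first by have /VlayerP := valP v'.
have hB x z t : h x (z - t) = h x z - h x t.
  by rewrite -scaleN1r herm_addr herm_scaler mulN1r.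
have hBl x z t : h (z - t) x = h z x - h t x.
  by apply/eqP; rewrite eq_sym subr_eq -herm_addl subrK.
have -> : h (\val u') (\val v') - h (\val u) (\val v)
        = h (\val u') (\val v' - \val v) + h (\val u' - \val u) (\val v).
  by rewrite hB hBl addrA subrK.
have [_ PD _] := pow_ideal A i.+1; apply: PD.
  by apply: herm_Vnull => //; exact: valP.
by apply: pow_symm; apply: herm_Vnull => //; exact: valP.
Qed.

End Layers.
Arguments hres {A star eps V} h y i w1 w2.

(* Main.v *)
(* Every form over a discrete valuation ring has an orthogonal Jordan splitting: in
   a suitable basis its Gram matrix is diag(c) G, with each c_a zero or a power of y,
   and with G invertible and block diagonal along the values of c.  The layer W(i) is
   spanned by the basis vectors with c_a = y^i, and the residue of the corresponding
   block of G is the Gram matrix of h_i.  Equivalences of all layers therefore lift to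
   a block matrix P such that P^* G' P is congruent to G modulo the maximal ideal;
   comparing the sizes of the blocks also matches the radicals.  The remaining
   discrepancy G1^-1 G, where G1 = P^* G' P, is self-adjoint for G1 and congruent to 1,
   so that, 2 being a unit and A complete, it has a self-adjoint square root Q, and
   Q^* G1 Q = G1 Q^2 = G. *)
Require Import Defs.
From HB Require Import structures.
From mathcomp Require Import all_boot all_order all_algebra.
From mathcomp Require Import boolp ring.
Import GRing.Theory.
Local Open Scope ring_scope.
Local Open Scope quotient_scope.

Set Implicit Arguments.
Unset Strict Implicit.
Unset Printing Implicit Defensive.

(** * Matrices graded by a valuation *)

Section Graded.
Variable R : comUnitRingType.

(** The values of [v] are exponents of the uniformiser, with [None] for the infinite exponent, that
    is, for the radical. *)
Definition diagv n (v : 'I_n -> option nat) (d : option nat -> R) : 'M[R]_n :=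
  diag_mx (\row_a d (v a)).

(** Block diagonality along the values, encoded as intertwining of all diagonal matrices that depend
    only on the value: products, inverses and adjoints inherit it by moving the diagonal factor
    across. *)
Definition graded m n (v : 'I_m -> option nat) (w : 'I_n -> option nat)
    (M : 'M[R]_(m, n)) : Prop :=
  forall d, diagv v d *m M = M *m diagv w d.

Lemma gradedP m n (v : 'I_m -> option nat) (w : 'I_n -> option nat)
    (M : 'M[R]_(m, n)) :
  graded v w M <-> forall a b, v a <> w b -> M a b = 0.
Proof.
split=> [gM a b vw | M0 d].
  (* The indicator of the value [v a] isolates the entry. *)
  have /matrixP/(_ a b) := gM (fun o => (o == v a)%:R).
  rewrite mul_diag_mx mul_mx_diag !mxE eqxx mul1r => ->.
  by case: eqP => [/esym//|_]; rewrite mulr0.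
apply/matrixP => a b; rewrite mul_diag_mx mul_mx_diag !mxE.
case: (v a =P w b) => [->|/M0->]; first by rewrite mulrC.
by rewrite mulr0 mul0r.
Qed.

Lemma gradedM m n p (v : 'I_m -> option nat) (w : 'I_n -> option nat)
    (u : 'I_p -> option nat) (M : 'M[R]_(m, n)) (N : 'M[R]_(n, p)) :
  graded v w M -> graded w u N -> graded v u (M *m N).
Proof. by move=> gM gN d; rewrite mulmxA gM -mulmxA gN mulmxA. Qed.

Lemma gradedD m n (v : 'I_m -> option nat) (w : 'I_n -> option nat)
    (M N : 'M[R]_(m, n)) :
  graded v w M -> graded v w N -> graded v w (M + N).
Proof. by move=> gM gN d; rewrite mulmxDr gM gN mulmxDl. Qed.

Lemma graded_invmx n (v : 'I_n -> option nat) (M : 'M[R]_n) :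
  M \in unitmx -> graded v v M -> graded v v (invmx M).
Proof.
move=> uM gM d; apply: (can_inj (mulKmx uM)).
by rewrite mulmxA -gM mulmxK // mulmxA mulmxV // mul1mx.
Qed.

(** Restricting to the rows and columns in [T] factors the identity of size [#|T|] through size
    [#|T'|], which over a nonzero commutative ring forces the inequality. *)
Lemma leq_card_mask n m (T : {set 'I_n}) (T' : {set 'I_m})
    (M : 'M[R]_(n, m)) (N : 'M[R]_(m, n)) :
    M *m diag_mx (\row_a (a \in T')%:R) *m N = diag_mx (\row_a (a \in T)%:R) ->
  (#|T| <= #|T'|)%N.
Proof.
move=> E.
pose S k (X : {set 'I_k}) : 'M[R]_(#|X|, k) := \matrix_(i, a) (enum_val i == a)%:R.
have S1 : S _ T *m diag_mx (\row_a (a \in T)%:R) *m (S _ T)^T = 1%:M.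
  rewrite mul_mx_diag; apply/matrixP => i j; rewrite !mxE.
  rewrite (bigD1 (enum_val i)) //= !mxE eqxx enum_valP !mul1r.
  rewrite (inj_eq enum_val_inj) eq_sym big1 ?addr0 // => a ia.
  by rewrite !mxE eq_sym (negPf ia) !mul0r.
have S2 : diag_mx (\row_a (a \in T')%:R) = (S _ T')^T *m S _ T'.
  apply/matrixP => a b; rewrite !mxE.
  have [aT|aT] := boolP (a \in T'); last first.
    rewrite mul0rn big1 // => i _; rewrite !mxE; case: eqP => [ia|_];
      last by rewrite mul0r.
    by move: aT; rewrite -ia enum_valP.
  rewrite (bigD1 (enum_rank_in aT a)) //= !mxE enum_rankK_in // eqxx mul1r.
  rewrite big1 ?addr0 // => i ia; rewrite !mxE.
  case: eqP => [ie|]; last by rewrite mul0r.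
  by case/eqP: ia; apply: enum_val_inj; rewrite enum_rankK_in.
apply: (@mulmx1_min R _ _ (S _ T *m M *m (S _ T')^T) (S _ T' *m N *m (S _ T)^T)).
by rewrite -[in RHS]S1 -E S2 !mulmxA.
Qed.

End Graded.

(** * Divisibility and limits in a complete discrete valuation ring *)

Section Dvr.
Variables (A : dvrType) (y : A).
Hypothesis yP : uniformiser y.

Lemma maxideal_divP a : a \in maxideal A <-> exists b, a = y * b.
Proof. by rewrite -[exists _, _]/(principal y a) -yP. Qed.

Lemma pow_divP i x : ideal_pow (rset A) i x <-> exists a, x = y ^+ i * a.
Proof.
split; first exact: pow_uniformiser.
by move=> [a ->]; apply: pow_uniformiserV.
Qed.

Lemma residue_unit (a : A) :
  (\pi_(residue A) a \is a GRing.unit) = (a \is a GRing.unit).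
Proof. by rewrite unitfE residue_eq0 maxidealE negbK. Qed.

Lemma residue_unitmx n (M : 'M[A]_n) :
  (map_mx \pi_(residue A) M \in unitmx) = (M \in unitmx).
Proof. by rewrite !unitmxE det_map_mx residue_unit. Qed.

Lemma residue_mx_eq m n (M N : 'M[A]_(m, n)) :
  map_mx \pi_(residue A) M = map_mx \pi_(residue A) N <->
  forall a b, M a b - N a b \in maxideal A.
Proof.
split=> [/matrixP E a b | E].
  by have /eqP := E a b; rewrite !mxE -subr_eq0 -rmorphB residue_eq0.
apply/matrixP => a b; rewrite !mxE; apply/eqP.
by rewrite -subr_eq0 -rmorphB residue_eq0.
Qed.

Lemma unitmx_congr n (M N : 'M[A]_n) :
  (forall a b, M a b - N a b \in maxideal A) -> (M \in unitmx) = (N \in unitmx).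
Proof. by move=> /residue_mx_eq E; rewrite -!residue_unitmx E. Qed.

Lemma mx_divP m n i (M : 'M[A]_(m, n)) :
  (forall a b, exists c, M a b = y ^+ i * c) <-> exists N, M = y ^+ i *: N.
Proof.
split=> [E | [N ->] a b]; last by exists (N a b); rewrite mxE.
have [N NE] := choice (fun ab => E ab.1 ab.2).
exists (\matrix_(a, b) N (a, b)); apply/matrixP => a b.
by rewrite !mxE -(NE (a, b)).
Qed.

Hypothesis A_complete : complete_dvr A.

Lemma dvr_separated x : (forall i, exists a, x = y ^+ i * a) -> x = 0.
Proof. by move=> xP; apply: A_complete.1 => i _; apply/pow_divP. Qed.

Lemma mx_separated m n (M : 'M[A]_(m, n)) :
  (forall i, exists N, M = y ^+ i *: N) -> M = 0.
Proof.
move=> MP; apply/matrixP => a b; rewrite mxE; apply: dvr_separated => i.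
by move/mx_divP: (MP i).
Qed.

Lemma mx_lim m n (u : nat -> 'M[A]_(m, n)) :
    (forall k, exists N, u k.+1 - u k = y ^+ k *: N) ->
  exists l, forall k, exists N, l = u k + y ^+ k *: N.
Proof.
move=> uP.
have uD k j : exists N, u (k + j)%N - u k = y ^+ k *: N.
  elim: j => [|j [N NE]]; first by exists 0; rewrite addn0 subrr scaler0.
  have [N' N'E] := uP (k + j)%N; exists (y ^+ j *: N' + N).
  by rewrite addnS scalerDr scalerA -exprD -N'E -NE addrA subrK.
have /choice[l lP] : forall ab : 'I_m * 'I_n,
    exists l, radic_cvg (fun k => u k ab.1 ab.2) l.
  move=> [a b] /=.
  apply: A_complete.2 => i; exists i => p q ip iq; apply/pow_divP.
  have [N NE] := uD i (p - i)%N; have [N' N'E] := uD i (q - i)%N.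
  move: NE N'E; rewrite !subnKC // => /matrixP/(_ a b) NE /matrixP/(_ a b) N'E.
  exists (N a b - N' a b); rewrite mulrBr.
  by move: NE N'E; rewrite !mxE => <- <-; rewrite opprB addrA subrK.
exists (\matrix_(a, b) l (a, b)) => k.
suff [N NE] : exists N, \matrix_(a, b) l (a, b) - u k = y ^+ k *: N.
  by exists N; rewrite -NE addrC subrK.
apply/mx_divP => a b; rewrite !mxE.
have [p pP] := lP (a, b) k.
(* The index [k + p] lies beyond [k] and beyond the point from which the sequence is within [y ^+ k]
   of its limit. *)
have /pow_divP[c cE] := pP (k + p)%N (leq_addl _ _).
have [N /matrixP/(_ a b)] := uD k p; rewrite !mxE => NE.
exists (N a b - c); rewrite mulrBr -NE -cE /= opprB.
by rewrite [RHS]addrC addrA subrK.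
Qed.

End Dvr.

(** * Conjugate transposes *)

Section Adjoint.
Variables (A : comUnitRingType) (star : involutive_rmorphism A).

Definition ctr m n (M : 'M[A]_(m, n)) : 'M[A]_(n, m) := (map_mx star M)^T.

Lemma ctrE m n (M : 'M[A]_(m, n)) a b : ctr M a b = star (M b a).
Proof. by rewrite !mxE. Qed.

Lemma ctrM m n p (M : 'M[A]_(m, n)) (N : 'M[A]_(n, p)) :
  ctr (M *m N) = ctr N *m ctr M.
Proof. by rewrite /ctr map_mxM trmx_mul. Qed.

Lemma ctrD m n (M N : 'M[A]_(m, n)) : ctr (M + N) = ctr M + ctr N.
Proof. by rewrite /ctr map_mxD raddfD. Qed.

Lemma ctrB m n (M N : 'M[A]_(m, n)) : ctr (M - N) = ctr M - ctr N.
Proof. by rewrite /ctr map_mxB raddfB. Qed.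

Lemma ctrZ m n a (M : 'M[A]_(m, n)) : ctr (a *: M) = star a *: ctr M.
Proof. by rewrite /ctr map_mxZ linearZ. Qed.

Lemma ctrK m n (M : 'M[A]_(m, n)) : ctr (ctr M) = M.
Proof. by apply/matrixP => a b; rewrite !ctrE rmorphK. Qed.

Lemma ctr0 m n : ctr (0 : 'M_(m, n)) = 0.
Proof. by rewrite /ctr map_mx0 trmx0. Qed.

Lemma ctr1 n : ctr 1%:M = 1%:M :> 'M_n.
Proof. by rewrite /ctr map_mx1 trmx1. Qed.

Lemma ctr_delta m n (i : 'I_m) (j : 'I_n) : ctr (delta_mx i j) = delta_mx j i.
Proof. by apply/matrixP => a b; rewrite !mxE rmorph_nat andbC. Qed.

Lemma ctr_unitmx n (M : 'M[A]_n) : M \in unitmx -> ctr M \in unitmx.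
Proof.
move=> uM; rewrite /ctr unitmx_tr unitmxE det_map_mx; apply: rmorph_unit.
by rewrite -unitmxE.
Qed.

Lemma ctr_block m1 m2 n1 n2 (a : 'M[A]_(m1, n1)) (b : 'M[A]_(m1, n2))
    (c : 'M[A]_(m2, n1)) (d : 'M[A]_(m2, n2)) :
  ctr (block_mx a b c d) = block_mx (ctr a) (ctr c) (ctr b) (ctr d).
Proof. by rewrite /ctr map_block_mx tr_block_mx. Qed.

Lemma graded_ctr m n (v : 'I_m -> option nat) (w : 'I_n -> option nat)
    (M : 'M[A]_(m, n)) : graded v w M -> graded w v (ctr M).
Proof.
move=> /gradedP M0; apply/gradedP => a b vw.
by rewrite ctrE M0 ?rmorph0 // => /esym.
Qed.

Lemma herm_congr eps m n (H : 'M[A]_m) (P : 'M[A]_(m, n)) :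
  H = eps *: ctr H -> ctr P *m H *m P = eps *: ctr (ctr P *m H *m P).
Proof.
by move=> HE; rewrite !ctrM ctrK [in LHS]HE -scalemxAr -scalemxAl mulmxA.
Qed.

End Adjoint.

(** * Self-adjoint square roots *)

Section SquareRoot.
Variables (A : dvrType) (y : A) (star : involutive_rmorphism A) (s : A).
Hypothesis yP : uniformiser y.
Hypothesis A_complete : complete_dvr A.
Hypothesis two_unit : (2%:R : A) \is a GRing.unit.
Hypothesis star_y : star y = s * y.
Variables (n : nat) (X : 'M[A]_n).

Let h : A := 2%:R^-1.

(** Newton's iteration for the square root of [X], with the inverse of [2 Q] replaced by the
    constant [1/2], as [Q] stays congruent to 1. *)
Let root_step (Q : 'M[A]_n) : 'M[A]_n := Q + h *: (X - Q *m Q).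

Let hD : h + h = 1.
Proof. by rewrite -mulr2n -mulr_natl mulrV. Qed.

(** With [E = X - Q^2] the new error is [(1 - Q) E - E^2 / 4]; both terms gain a factor [y] over [E]
    when [Q] is congruent to 1 and [E] to 0 modulo [y]. *)
Lemma root_stepE Q : comm_mx X Q ->
  X - root_step Q *m root_step Q =
    (1%:M - Q) *m (X - Q *m Q) - h ^+ 2 *: ((X - Q *m Q) *m (X - Q *m Q)).
Proof.
move=> XQ; rewrite /root_step; set E := X - Q *m Q.
have EQ : E *m Q = Q *m E by rewrite /E mulmxBl mulmxBr XQ mulmxA.
have -> : X = E + Q *m Q by rewrite subrK.
clearbody E; rewrite !(mulmxDl, mulmxDr) mulNmx mul1mx.
rewrite -!(scalemxAl, scalemxAr) scalerA EQ -expr2 -!addrA opprD addNKr.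
by rewrite [_ *: _ + (_ + _)]addrA -scalerDl hD scale1r opprD.
Qed.

(** The iterates are polynomials in [X], so they are self-adjoint for [G] and commute with whatever
    commutes with [X]. Both properties pass to the limit because they hold modulo every power of
    [y]. The commutation clause serves to make [Q] graded. *)
Lemma sqrt_mx (G : 'M[A]_n) :
    (exists R, X = 1%:M + y *: R) -> ctr star X *m G = G *m X ->
  exists Q, [/\ Q *m Q = X, ctr star Q *m G = G *m Q &
             forall Z, comm_mx Z X -> comm_mx Z Q].
Proof.
move=> [R XR] XG; pose u k := iter k root_step 1%:M.
have starh : star h = h by rewrite /h rmorphV // rmorph_nat.
have starX k : star (y ^+ k) = s ^+ k * y ^+ k.
  by rewrite rmorphXn /= star_y exprMn.
have uX Z k : comm_mx Z X -> comm_mx Z (u k).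
  move=> ZX; elim: k => [|k IH]; first exact: comm_mx1.
  apply: comm_mxD => //; rewrite /comm_mx -scalemxAr -scalemxAl; congr (_ *: _).
  by apply: comm_mxB => //; apply: comm_mxM.
have uG k : ctr star (u k) *m G = G *m u k.
  elim: k => [|k IH]; first by rewrite ctr1 mul1mx mulmx1.
  rewrite /= -/(u k) /root_step ctrD ctrZ ctrB ctrM starh.
  rewrite mulmxDl mulmxDr IH -scalemxAl -scalemxAr mulmxBl mulmxBr XG.
  by rewrite -mulmxA IH mulmxA IH mulmxA.
(* The error is divisible by [y] at the start and gains one factor [y] per step. *)
have uE k : (exists S, u k = 1%:M + y *: S) /\
            exists N, X - u k *m u k = y ^+ k.+1 *: N.
  elim: k => [|k [[S uS] [N uN]]].
    split; first by exists 0; rewrite scaler0 addr0.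
    by exists R; rewrite mulmx1 XR addrC addKr expr1.
  split.
    exists (S + (h * y ^+ k) *: N).
    rewrite /= -/(u k) /root_step uN {1}uS scalerDr !scalerA addrA.
    by congr (_ + _ *: _); rewrite exprS mulrCA.
  exists (- (S *m N) - (h ^+ 2 * y ^+ k) *: (N *m N)).
  rewrite /= -/(u k) root_stepE; last exact/uX/comm_mx_refl.
  rewrite uN {1}uS opprD addrA subrr add0r scalerBr scalerN.
  rewrite -!scalemxAl -!scalemxAr !scalerA.
  rewrite mulNmx -scalemxAl scalerN scalerA -exprSr; congr (_ - _ *: _).
  by rewrite !exprS; ring.
have [k|Q QP] := mx_lim yP A_complete (u := u).
  have [_ [N uN]] := uE k; exists ((h * y) *: N).
  rewrite /= -/(u k) /root_step addrC addKr uN scalerA exprS mulrA.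
  by rewrite [_ * y ^+ k]mulrC scalerA.
exists Q; split.
- apply/eqP; rewrite -subr_eq0; apply/eqP/(mx_separated yP A_complete) => k.
  have [N QN] := QP k; have [_ [M uM]] := uE k.
  exists (u k *m N + N *m Q - y *: M).
  rewrite scalerBr scalerA -exprSr -uM opprB addrA; congr (_ - _).
  rewrite {1}QN mulmxDl [X in u k *m X]QN mulmxDr scalerDr.
  by rewrite -scalemxAl -scalemxAr -addrA addrC.
- apply/eqP; rewrite -subr_eq0; apply/eqP/(mx_separated yP A_complete) => k.
  (* The adjoint of the remainder [y ^+ k *: N] is still divisible by [y ^+ k], since [star] only
     multiplies this power by [s ^+ k]. *)
  have [N QN] := QP k; exists (s ^+ k *: (ctr star N *m G) - G *m N).
  rewrite {1 2}QN ctrD ctrZ starX mulmxDl mulmxDr uG opprD.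
  rewrite addrACA subrr add0r -scalemxAl -scalemxAr scalerBr scalerA.
  by rewrite [s ^+ k * _]mulrC.
- move=> Z ZX; apply/eqP; rewrite -subr_eq0.
  apply/eqP/(mx_separated yP A_complete) => k.
  have [N QN] := QP k; exists (Z *m N - N *m Z).
  rewrite QN mulmxDl mulmxDr (uX _ k ZX) opprD addrACA subrr add0r.
  by rewrite -scalemxAl -scalemxAr scalerBr.
Qed.

End SquareRoot.

(** * Jordan splittings *)

Section Splitting.
Variables (A : dvrType) (star : involutive_rmorphism A).

Lemma star_maxideal a : a \in maxideal A -> star a \in maxideal A.
Proof.
rewrite !maxidealE; apply: contra => aU.
by rewrite -[a](rmorphK star) rmorph_unit.
Qed.

(** A lift of a base change over the residue field makes the last [m] columns vanish modulo the
    maximal ideal. The leading block of size [k] is then invertible and serves as pivot to clear the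
    off-diagonal blocks. *)
Lemma unimodular_split k m eps (H : 'M[A]_(k + m)) :
    H = eps *: ctr star H -> \rank (map_mx \pi_(residue A) H) = k ->
  exists P C F, [/\ P \in unitmx, C \in unitmx
                  & ctr star P *m H *m P = block_mx C 0 0 F].
Proof.
move=> HE; set Hb := map_mx _ H => rk.
pose P : 'M[A]_(k + m) := map_mx repr (invmx (row_ebase Hb)).
have PE : map_mx \pi_(residue A) P = invmx (row_ebase Hb).
  by apply/matrixP => a b; rewrite !mxE reprK.
have uP : P \in unitmx by rewrite -residue_unitmx PE unitmx_inv row_ebase_unit.
pose N := map_mx \pi_(residue A) (ctr star P) *m col_ebase Hb.
have uN : N \in unitmx.
  by rewrite unitmx_mul residue_unitmx ctr_unitmx // col_ebase_unit.
have [H1 H1P] : exists H1, H1 = ctr star P *m H *m P by eexists.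
have H1E : H1 = eps *: ctr star H1 by rewrite H1P; apply: herm_congr.
have H1N : map_mx \pi_(residue A) H1 = N *m block_mx 1%:M 0 0 0.
  rewrite H1P !map_mxM PE -/Hb -[X in _ *m X *m _]mulmx_ebase rk.
  by rewrite -pid_mx_block !mulmxA mulmxK ?row_ebase_unit.
move: H1N; rewrite -[H1 in LHS]submxK -[N in RHS]submxK mulmx_block.
rewrite !mulmx0 !mulmx1 !addr0 map_block_mx => /eq_block_mx[Cb Bb Db _].
(* The upper right block of [H1] has residue 0, hence by hermitian symmetry so has the lower left
   one; thus [N] is block upper triangular and its leading corner is invertible. *)
have D0 : dlsubmx N = 0.
  rewrite -Db; apply/matrixP => a b; rewrite mxE [RHS]mxE; apply/eqP.
  rewrite residue_eq0 H1E !mxE idealMr // star_maxideal // -residue_eq0.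
  by move/matrixP/(_ b a)/eqP: Bb; rewrite !mxE.
set C := ulsubmx H1 in Cb.
have uC : C \in unitmx.
  rewrite -residue_unitmx Cb; move: uN; rewrite -[X in X \in _ -> _]submxK D0.
  by rewrite !unitmxE det_ublock unitrM => /andP[].
(* This clears the upper right block; the lower left one then vanishes by hermitian symmetry. *)
pose Q : 'M[A]_(k + m) := block_mx 1%:M (- (invmx C *m ursubmx H1)) 0 1%:M.
have uQ : Q \in unitmx by rewrite unitmxE det_ublock !det1 mulr1 unitr1.
have QE : ctr star Q *m H1 *m Q = eps *: ctr star (ctr star Q *m H1 *m Q).
  exact: herm_congr.
pose F := dlsubmx H1 *m - (invmx C *m ursubmx H1) + drsubmx H1.
have QF : exists D, ctr star Q *m H1 *m Q = block_mx C 0 D F.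
  exists (ctr star (- (invmx C *m ursubmx H1)) *m C + dlsubmx H1).
  rewrite -[X in _ *m X *m _]submxK -mulmxA mulmx_block !mulmx0 !mulmx1 !addr0 -/C.
  rewrite mulmxN mulKVmx // addNr ctr_block !ctr1 mulmx_block !mul1mx -/F.
  by rewrite ctr0 !mul0mx !mulmx0 !addr0 add0r.
exists (P *m Q), C, F; split; rewrite ?unitmx_mul ?uP //.
rewrite ctrM -!mulmxA 2![X in _ *m X = _]mulmxA -H1P mulmxA.
have [D QD] := QF; rewrite QD; congr block_mx.
move: QE; rewrite QD ctr_block scale_block_mx => /eq_block_mx[_ _ -> _].
by rewrite ctr0 scaler0.
Qed.

End Splitting.

Section Jordan.
Variables (A : dvrType) (y : A) (star : involutive_rmorphism A) (s : A).
Hypothesis yP : uniformiser y.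
Hypothesis A_complete : complete_dvr A.
Hypothesis star_y : star y = s * y.

Definition pow_opt (o : option nat) : A := if o is Some i then y ^+ i else 0.

(* [v a = None] marks the basis vectors spanning the radical, where [G] is
   normalised to be the identity. *)
Definition jordan n (H : 'M[A]_n) (v : 'I_n -> option nat) (G P : 'M[A]_n) : Prop :=
  [/\ P \in unitmx, G \in unitmx, graded v v G,
      forall a b, v a = None -> G a b = (a == b)%:R &
      ctr star P *m H *m P = diagv v pow_opt *m G].

(** Otherwise one more factor [y] could always be extracted, and [H], divisible by all powers of
    [y], would be 0. *)
Lemma mx_content n (H : 'M[A]_n) : H <> 0 ->
  exists i H', H = y ^+ i *: H' /\ map_mx \pi_(residue A) H' <> 0.
Proof.
move=> H0; apply: contrapT => noH; apply: H0.
apply: (mx_separated yP A_complete) => i.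
elim: i => [|i [N HN]]; first by exists H; rewrite expr0 scale1r.
have /residue_mx_eq N0 : map_mx \pi_(residue A) N = map_mx \pi_(residue A) 0.
  apply: contrapT => N0; apply: noH; exists i, N; split=> //.
  by rewrite map_mx0 in N0.
have [a b|N' NE] := (mx_divP y 1 N).1.
  by have := N0 a b; rewrite mxE subr0 => /(maxideal_divP yP); rewrite expr1.
by exists N'; rewrite HN NE scalerA -exprD addn1.
Qed.

(** Strong induction on the size: the largest power of [y] is divided out, an invertible block of
    the quotient is split off, and the complement is smaller. The scalar [eps] varies in the
    induction. *)
Lemma jordan_exists n eps (H : 'M[A]_n) : H = eps *: ctr star H ->
  exists v G P, jordan H v G P.
Proof.
have y0 := uniformiser_neq0 yP.
elim/ltn_ind: n eps H => n IH eps H HE.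
have [->|/mx_content[i [H' [HH' H'0]]]] := pselect (H = 0).
  exists (fun=> None), 1%:M, 1%:M; split; rewrite ?unitmx1 //.
  - by move=> d; rewrite mulmx1 mul1mx.
  - by move=> a b _; rewrite mxE.
  - rewrite mulmx0 mul0mx mulmx1; apply/matrixP => a b.
    by rewrite !mxE mul0rn.
(* Dividing by [y ^+ i] changes the symmetry factor by [s ^+ i], because [star y = s * y]. *)
have H'E : H' = (eps * s ^+ i) *: ctr star H'.
  have : y ^+ i *: H' = y ^+ i *: ((eps * s ^+ i) *: ctr star H').
    rewrite -HH' [LHS]HE HH' ctrZ rmorphXn /= star_y exprMn !scalerA.
    by congr (_ *: _); ring.
  move/matrixP=> E; apply/matrixP => a b; apply: (mulfI (expf_neq0 i y0)).
  by move: (E a b); rewrite !mxE.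
move: (rank_leq_row (map_mx \pi_(residue A) H')).
have: (0 < \rank (map_mx \pi_(residue A) H'))%N by rewrite lt0n mxrank_eq0; apply/eqP.
move: (erefl (\rank (map_mx \pi_(residue A) H'))); move: {2 3 4}(\rank _) => k rk k0 kn.
have [m nE] : exists m, n = (k + m)%N by exists (n - k)%N; rewrite subnKC.
subst n => {kn}; have [P [C [F [uP uC PE]]]] := unimodular_split H'E rk.
have FE : F = (eps * s ^+ i) *: ctr star F.
  have := herm_congr P H'E; rewrite PE ctr_block scale_block_mx.
  by case/eq_block_mx.
have [|v [G [P2 [uP2 uG gG G0 P2E]]]] := IH m _ _ _ FE.
  by rewrite -addn1 addnC leq_add2r.
(* The complement comes from the quotient [H'], so its finite exponents are raised by [i]. *)
pose w (a : 'I_(k + m)) :=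
  match split a with inl _ => Some i | inr b => omap (addn i) (v b) end.
exists w, (block_mx C 0 0 G), (P *m block_mx 1%:M 0 0 P2).
have wl a : w (lshift m a) = Some i by rewrite /w (unsplitK (inl a)).
have wr b : w (rshift k b) = omap (addn i) (v b) by rewrite /w (unsplitK (inr b)).
split.
- by rewrite unitmx_mul uP unitmxE det_ublock det1 mul1r -unitmxE.
- by rewrite unitmxE det_ublock unitrM -!unitmxE uC.
- apply/gradedP => a b; case: (split_ordP a) => a' ->; case: (split_ordP b) => b' ->;
    rewrite ?wl ?wr ?block_mxEul ?block_mxEur ?block_mxEdl ?block_mxEdr ?mxE //.
  by move=> vab; move/gradedP: gG; apply=> vE; apply: vab; rewrite vE.
- move=> a b; case: (split_ordP a) => a' ->; rewrite ?wl ?wr //.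
  case va : (v a') => // _; case: (split_ordP b) => b' ->.
    by rewrite block_mxEdl mxE eq_rlshift.
  by rewrite block_mxEdr (G0 _ _ va) eq_rshift.
- set B := block_mx 1%:M 0 0 P2.
  have -> : ctr star (P *m B) *m H *m (P *m B) =
            y ^+ i *: (ctr star B *m (ctr star P *m H' *m P) *m B).
    by rewrite ctrM HH' -scalemxAr -scalemxAl !mulmxA.
  rewrite PE ctr_block !mulmx_block.
  rewrite !(ctr0, mulmx0, mul0mx, addr0, add0r) ctr1 mul1mx mulmx1.
  rewrite P2E /diagv !mul_diag_mx.
  apply/matrixP => a b; rewrite [LHS]mxE [RHS]mxE [X in _ = X * _]mxE.
  case: (split_ordP a) => a' ->; case: (split_ordP b) => b' ->;
    rewrite ?wl ?wr ?block_mxEul ?block_mxEur ?block_mxEdl ?block_mxEdr ?mxE ?mulr0 //.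
  rewrite mulrA; congr (_ * _).
  by case: (v a') => [j|]; rewrite ?mulr0 //= exprD.
Qed.

End Jordan.

(** * The layers in Jordan coordinates *)

Section Layers.
Variables (A : dvrType) (y : A) (star : involutive_rmorphism A) (eps : A).
Variables (V : lmodType A).
Hypothesis yP : uniformiser y.

Definition jordan_coord (h : herm_form star eps V) n (v : 'I_n -> option nat)
    (G : 'M[A]_n) (E : {linear 'cV[A]_n -> V}) : Prop :=
  [/\ forall u, exists x, u = E x, G \in unitmx, graded v v G &
      forall x z, h (E x) (E z)
                    = (ctr star x *m (diagv v (pow_opt y) *m (G *m z))) 0 0].

Definition layer_mask n (v : 'I_n -> option nat) i : 'M[A]_n :=
  diagv v (fun o => (o == Some i)%:R).

Lemma diagvE n (v : 'I_n -> option nat) d (z : 'cV[A]_n) a :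
  (diagv v d *m z) a 0 = d (v a) * z a 0.
Proof. by rewrite /diagv mul_diag_mx !mxE. Qed.

Section OneForm.
Variables (h : herm_form star eps V) (n : nat) (v : 'I_n -> option nat).
Variables (G : 'M[A]_n) (E : {linear 'cV[A]_n -> V}).
Hypothesis hE : jordan_coord h v G E.

(** Membership in [V(i)] can be tested on the basis vectors, and pairing with the one of index [a]
    yields the coordinate shown. *)
Lemma Vlayer_coordP i z :
  E z \in Vlayer h i <->
  forall a, exists c, pow_opt y (v a) * (G *m z) a 0 = y ^+ i * c.
Proof.
have [Esurj uG gG hEE] := hE; split=> [/VlayerP Ez a | Ez].
  have /(pow_divP yP)[c] := Ez (E (delta_mx a 0)).
  by rewrite hEE ctr_delta -rowE mxE diagvE => ->; exists c.
apply/VlayerP => u; have [x ->] := Esurj u; apply/(pow_divP yP).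
have [c cE] := choice Ez.
exists (\sum_a star (x a 0) * c a); rewrite hEE mxE mulr_sumr.
by apply: eq_bigr => a _; rewrite ctrE diagvE cE mulrCA.
Qed.

Lemma layer_mask_in i z : E (layer_mask v i *m z) \in Vlayer h i.
Proof.
have [Esurj uG gG hEE] := hE; apply/Vlayer_coordP => a.
rewrite mulmxA -gG -mulmxA diagvE.
case: eqP => [->|_]; last by exists 0; rewrite mul0r !mulr0.
by exists ((G *m z) a 0); rewrite mul1r.
Qed.

(** Coordinates of exponent below [i] contribute to [r V(i - 1)] and those above [i] to [V(i + 1)],
    so [W(i)] is spanned by vectors supported on exponent [i]. *)
Lemma Vnull_layer_mask i z :
  E z \in Vlayer h i -> Vnull h i (E z - E (layer_mask v i *m z)).
Proof.
have [Esurj uG gG hEE] := hE => /Vlayer_coordP Ez.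
pose lt o := if o is Some j then (j < i)%N else false.
pose gt o := if o is Some j then (i < j)%N else true.
pose L := diagv v (fun o => (lt o)%:R : A); pose U := diagv v (fun o => (gt o)%:R : A).
have zE : z - layer_mask v i *m z = L *m z + U *m z.
  apply/matrixP => a b; rewrite ord1 mxE [in RHS]mxE [X in _ + X]mxE !diagvE /lt /gt.
  case: (v a) => [j|]; last by rewrite !mul0r subr0 add0r mul1r.
  rewrite (inj_eq Some_inj).
  by case: ltngtP => _; rewrite ?mul1r ?mul0r ?subrr ?subr0 ?addr0 ?add0r.
exists (E (L *m z)), (E (U *m z)); split; last by rewrite -!raddfB -raddfD zE.
(* For an exponent [j < i], the coordinate of [G *m z] is divisible by [y ^+ (i - j)]; [w] is its
   quotient by [y], and is 0 elsewhere. *)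
- have /choice[w wE] : forall a, exists w,
      (L *m (G *m z)) a 0 = y * w /\ exists c, pow_opt y (v a) * w = y ^+ i.-1 * c.
    move=> a; rewrite diagvE /lt; case va: (v a) => [j|]; last first.
      by exists 0; split; [rewrite mul0r mulr0 | exists 0; rewrite !mulr0].
    case: ltnP => ji; last first.
      by exists 0; split; [rewrite mul0r mulr0 | exists 0; rewrite !mulr0].
    have [c] := Ez a; rewrite va /= -(subnKC ji) => cE.
    exists (y ^+ (i - j.+1) * c); split.
      rewrite mul1r; apply: (mulfI (expf_neq0 j (uniformiser_neq0 yP))).
      by rewrite cE exprD exprS; ring.
    by exists c; rewrite mulrA -exprD.
  pose z' := invmx G *m (\col_a w a).
  have -> : L *m z = y *: z'.
    apply: (can_inj (mulKmx uG)); rewrite -scalemxAr mulKVmx // mulmxA -gG -mulmxA.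
    by apply/matrixP => a b; rewrite ord1 (wE a).1 !mxE.
  rewrite linearZ; apply: smulM.
    by rewrite /rset /= (maxideal_divP yP); exists 1; rewrite mulr1.
  (* For [i = 0] no exponent lies below [i], so the vector is 0, as [V(-1) = 0] demands. *)
  case: i @lt @gt @L @U zE wE Ez => [|i] lt gt L U zE wE Ez /=.
    rewrite /z'; suff -> : \col_a w a = 0 by rewrite mulmx0 linear0.
    apply/matrixP => a b; rewrite !mxE; have := (wE a).1; rewrite diagvE.
    have -> : lt (v a) = false by rewrite /lt; case: (v a).
    rewrite mul0r => /esym/eqP; rewrite mulf_eq0 (negPf (uniformiser_neq0 yP)).
    by move/eqP.
  apply/Vlayer_coordP => a; have [c cE] := (wE a).2; exists c.
  by rewrite /z' mulKVmx // mxE.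
- apply/Vlayer_coordP => a; rewrite mulmxA -gG -mulmxA diagvE /gt.
  case: (v a) => [j|]; last by exists 0; rewrite mul0r mulr0.
  case: ltnP => ij; last by exists 0; rewrite mul0r !mulr0.
  exists (y ^+ (j - i.+1) * (G *m z) a 0).
  by rewrite /= mul1r mulrA -exprD subnKC.
Qed.

End OneForm.

(** Column [a] of [p] represents the image of the class of basis vector [a], projected to the
    coordinates of exponent [i]. Both Gram matrices carry the factor [y ^+ i] there, and dividing by
    it compares them in the residue field. *)
Lemma layer_isometry (h h' : herm_form star eps V) n n' (v : 'I_n -> option nat)
    (v' : 'I_n' -> option nat) G G' E E' i :
    jordan_coord h v G E -> jordan_coord h' v' G' E' ->
    equivalent (hres h y i) (hres h' y i) ->
  exists p : 'M[A]_(n', n),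
    (forall c a, v' c <> Some i -> p c a = 0) /\
    forall a b, v a = Some i -> v b = Some i ->
      (ctr star p *m G' *m p) a b - G a b \in maxideal A.
Proof.
move=> hE hE' [phi _ phiE].
have y0 := uniformiser_neq0 yP.
have [Esurj uG gG hEE] := hE; have [E'surj uG' gG' hEE'] := hE'.
pose e (z : 'cV[A]_n) : Vsub h i :=
  Sub (E (layer_mask v i *m z)) (layer_mask_in hE i z).
pose e' (z : 'cV[A]_n') : Vsub h' i :=
  Sub (E' (layer_mask v' i *m z)) (layer_mask_in hE' i z).
have span (w : W h' i) : exists z, w = \pi_(W h' i) (e' z).
  have [z zE] := E'surj (\val (repr w)); exists z; rewrite -[LHS]reprK.
  apply/W_eq; rewrite SubK zE; apply: (Vnull_layer_mask hE').
  by rewrite -zE; apply: valP.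
have /choice[p pE] a := span (phi (\pi_(W h i) (e (delta_mx a 0)))).
pose P : 'M[A]_(n', n) := \matrix_(c, a) (layer_mask v' i *m p a) c 0.
have P0 c a : v' c <> Some i -> P c a = 0.
  by move=> vc; rewrite mxE diagvE; case: eqP; rewrite ?mul0r.
exists P; split=> // a b va vb.
have mask x : v x = Some i -> layer_mask v i *m delta_mx x 0 = delta_mx x 0 :> 'cV[A]_n.
  move=> vx; apply/matrixP => c d; rewrite ord1 diagvE !mxE.
  by case: (c =P x) => [->|]; rewrite ?mulr0 // vx !eqxx mul1r.
have := phiE (\pi_(W h i) (e (delta_mx a 0))) (\pi_(W h i) (e (delta_mx b 0))).
rewrite !pE !hresE // !SubK !mask // hEE hEE'.
have colP x : layer_mask v' i *m p x = col x P.
  by apply/matrixP => c d; rewrite ord1 !mxE.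
rewrite !colP.
have -> : (ctr star (delta_mx a 0 : 'cV[A]_n) *m
           (diagv v (pow_opt y) *m (G *m (delta_mx b 0 : 'cV[A]_n)))) 0 0
    = y ^+ i * G a b.
  by rewrite ctr_delta -rowE mxE diagvE va -colE mxE.
have -> : (ctr star (col a P) *m (diagv v' (pow_opt y) *m (G' *m col b P))) 0 0
    = y ^+ i * (ctr star P *m G' *m P) a b.
  have -> : G' *m col b P = col b (G' *m P) by rewrite !colE mulmxA.
  rewrite -mulmxA mxE [in RHS]mxE mulr_sumr; apply: eq_bigr => c _.
  rewrite !ctrE diagvE [col a P c 0]mxE [col b _ c 0]mxE.
  case: (v' c =P Some i) => [->|/P0 ->]; first by rewrite mulrCA.
  by rewrite rmorph0 !mul0r mulr0.
rewrite !divpowE // => /eqP; rewrite eq_sym -subr_eq0 -rmorphB residue_eq0.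
by [].
Qed.

End Layers.

(** * Lifting isometries of the layers *)

Lemma equivalent_sym (R : nzRingType) (V1 V2 : lmodType R)
    (h1 : V1 -> V1 -> R) (h2 : V2 -> V2 -> R) :
  equivalent h1 h2 -> equivalent h2 h1.
Proof.
move=> [phi [psi phiK psiK] phiE].
pose psiL := GRing.isLinear.Build _ _ _ _ psi (can2_linear phiK psiK).
pose psi' : {linear V2 -> V1} := HB.pack psi psiL.
by exists psi' => [|u v]; [exists phi | rewrite phiE /= !psiK].
Qed.

(** Elements of [T] go to the elements of [T'] at the same position in the enumerations. *)
Lemma exists_inj_in n (T T' : {set 'I_n}) : (#|T| <= #|T'|)%N ->
  exists f : 'I_n -> 'I_n, (forall a, a \in T -> f a \in T') /\ {in T &, injective f}.
Proof.
move=> leT; pose f a := nth a (enum T') (index a (enum T)).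
have ltT a : a \in T -> (index a (enum T) < size (enum T'))%N.
  by move=> aT; rewrite -cardE (leq_trans _ leT) // cardE index_mem mem_enum.
exists f; split=> [a aT | a b aT bT].
  by rewrite -mem_enum mem_nth ?ltT.
rewrite /f (set_nth_default a) ?ltT // => /eqP.
rewrite nth_uniq ?enum_uniq ?ltT // => /eqP /(congr1 (nth a (enum T))).
by rewrite !nth_index ?mem_enum.
Qed.

Section Assembly.
Variables (A : dvrType) (y : A) (star : involutive_rmorphism A) (eps s : A).
Hypothesis yP : uniformiser y.
Hypothesis A_complete : complete_dvr A.
Hypothesis two_unit : (2%:R : A) \is a GRing.unit.
Hypothesis star_y : star y = s * y.
Hypotheses (s2 : s * s = 1) (eps2 : eps * eps = 1).

(** The symmetry factor of each block of [G]; on the radical [G] is the identity, whence the value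
    1. *)
Definition twist (o : option nat) : A := if o is Some i then eps * s ^+ i else 1.

Lemma twist2 o : twist o * twist o = 1.
Proof.
by case: o => [i|] /=; rewrite ?mulr1 // mulrACA eps2 -exprMn s2 expr1n mulr1.
Qed.

Lemma jordan_herm n (H : 'M[A]_n) v G P :
  H = eps *: ctr star H -> jordan y star H v G P -> ctr star G = diagv v twist *m G.
Proof.
move=> HE [_ _ /gradedP gG G0 PE].
have := herm_congr P HE; rewrite PE => JE; apply/matrixP => a b.
rewrite ctrE mul_diag_mx !mxE.
have [vab|/eqP vab] := eqVneq (v a) (v b); last first.
  by rewrite !gG ?rmorph0 ?mulr0 // => /esym.
case va : (v a) (vab) => [i|] /= /esym vb; last first.
  by rewrite !G0 // rmorph_nat mul1r eq_sym.
move/matrixP/(_ a b): JE; rewrite [RHS]mxE ctrE !mul_diag_mx !mxE va vb /=.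
rewrite rmorphM rmorphXn /= star_y => E.
(* Within one block the factor [y ^+ i] cancels, and [star] leaves [s ^+ i] behind. *)
have {}E : G a b = eps * s ^+ i * star (G b a).
  apply: (mulfI (expf_neq0 i (uniformiser_neq0 yP))); rewrite E exprMn; ring.
by rewrite E mulrA [X in X * _](twist2 (Some i)) mul1r.
Qed.

Section Transfer.
Variables (V : lmodType A) (h h' : herm_form star eps V) (n : nat).
Variables (v v' : 'I_n -> option nat) (G G' : 'M[A]_n).
Variables (E E' : {linear 'cV[A]_n -> V}).
Hypotheses (hE : jordan_coord y h v G E) (hE' : jordan_coord y h' v' G' E').
Hypothesis G0 : forall a b, v a = None -> G a b = (a == b)%:R.
Hypothesis hh' : forall i, equivalent (hres h y i) (hres h' y i).

(** The columns of exponent [i] come from the isometry of the layer [i]. Those of the radical are 0,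
    and the added diagonal term supplies the identity block that [G] has there. *)
Lemma layers_isometry : exists p : 'M[A]_n,
  [/\ graded v' v p, forall c a, v a = None -> p c a = 0,
      ctr star p *m G' *m p + diagv v (fun o => (o == None)%:R) \in unitmx &
      forall a b, (ctr star p *m G' *m p + diagv v (fun o => (o == None)%:R)) a b
                    - G a b \in maxideal A].
Proof.
have [_ uG gG _] := hE; have [_ uG' gG' _] := hE'.
have /choice[q qP] i := layer_isometry yP hE hE' (hh' i).
pose p : 'M[A]_n := \matrix_(c, a) if v a is Some i then q i c a else 0.
have p0 c a : v a = None -> p c a = 0 by move=> va; rewrite mxE va.
have gp : graded v' v p.
  apply/gradedP => c a; rewrite mxE; case va: (v a) => [i|] // vc.
  by rewrite (qP i).1.
suff cong a b : (ctr star p *m G' *m p + diagv v (fun o => (o == None)%:R)) a b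
                  - G a b \in maxideal A.
  by exists p; split=> //; rewrite (unitmx_congr cong).
have gpp : graded v v (ctr star p *m G' *m p).
  by apply: (gradedM _ gp); apply: (gradedM _ gG'); apply: graded_ctr.
have DE : diagv v (fun o => (o == None)%:R) a b = (v a == None)%:R *+ (a == b) :> A.
  by rewrite !mxE.
rewrite mxE DE.
have [vab|/eqP vab] := eqVneq (v a) (v b); last first.
  move/gradedP: gpp => ->//; move/gradedP: gG => ->//.
  by case: (a =P b) vab => [->//|_]; rewrite mulr0n addr0 subr0 rpred0.
case va : (v a) => [i|] /=; last first.
  rewrite G0 // mxE big1 ?add0r ?subrr ?rpred0 // => c _.
  by rewrite [p c b]p0 ?mulr0 // -vab.
rewrite mul0rn addr0.
suff -> : (ctr star p *m G' *m p) a b = (ctr star (q i) *m G' *m q i) a b.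
  by apply: (qP i).2; rewrite -?vab.
rewrite !mxE; apply: eq_bigr => c _; rewrite [p c b]mxE -vab va; congr (_ * _).
by rewrite !mxE; apply: eq_bigr => d _; rewrite !ctrE mxE va.
Qed.

(** With [G1] the invertible matrix above, [p^* G' p G1^-1] is the projection onto the coordinates
    of finite exponent for [v], and it factors through those for [v'], where [p] has its nonzero
    rows. *)
Lemma leq_card_layers : (#|[set a | v a != None]| <= #|[set a | v' a != None]|)%N.
Proof.
have [p [/gradedP gp p0 uG1 _]] := layers_isometry.
set G1 := _ + _ in uG1.
apply: (leq_card_mask (M := ctr star p *m G') (N := p *m invmx G1)).
rewrite -mulmxA.
have -> : diag_mx (\row_a (a \in [set a | v' a != None])%:R) *m (p *m invmx G1)
           = p *m invmx G1.
  rewrite mulmxA; congr (_ *m _); apply/matrixP => c a.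
  rewrite mul_diag_mx !mxE inE; case: eqP => [vc|_]; last by rewrite mul1r.
  rewrite mul0r; case va: (v a) => [i|]; last by rewrite p0.
  by rewrite gp // vc va.
rewrite mulmxA; apply: (can_inj (mulmxK uG1)); rewrite mulmxKV //.
apply/matrixP => a b; rewrite mul_diag_mx [RHS]mxE [X in _ = X * _]mxE inE.
rewrite /G1 [X in _ = _ * X]mxE [X in _ = _ * (_ + X)]mxE.
rewrite [X in _ = _ * (_ + X *+ _)]mxE.
case va: (v a) => [i|] /=; first by rewrite mul0rn addr0 mul1r.
rewrite mul0r mxE big1 // => c _; rewrite mxE big1 ?mul0r // => d _.
by rewrite ctrE p0 // rmorph0 mul0r.
Qed.

End Transfer.

Section Lift.
Variables (V : lmodType A) (h h' : herm_form star eps V) (n : nat).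
Variables (v v' : 'I_n -> option nat) (G G' : 'M[A]_n).
Variables (E E' : {linear 'cV[A]_n -> V}).
Hypotheses (hE : jordan_coord y h v G E) (hE' : jordan_coord y h' v' G' E').
Hypothesis G0 : forall a b, v a = None -> G a b = (a == b)%:R.
Hypothesis G'0 : forall a b, v' a = None -> G' a b = (a == b)%:R.
Hypothesis hh' : forall i, equivalent (hres h y i) (hres h' y i).

(** The equivalences read backwards bound the radical rank of [h] by that of [h']. The radical basis
    vectors can then be sent injectively to radical ones, which replaces the added diagonal term by
    a genuine part of [p]. *)
Lemma congruent_isometry : exists p : 'M[A]_n,
  [/\ graded v' v p, ctr star p *m G' *m p \in unitmx &
      forall a b, (ctr star p *m G' *m p) a b - G a b \in maxideal A].
Proof.
have [p [gp p0 uG1 cong]] := layers_isometry hE hE' G0 hh'.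
have [_ _ /gradedP gG' _] := hE'.
have leT : (#|[set a | v a == None]| <= #|[set a | v' a == None]|)%N.
  have := leq_card_layers hE' hE G'0 (fun i => equivalent_sym (hh' i)).
  have cC (w : 'I_n -> option nat) : [set a | w a != None] = ~: [set a | w a == None].
    by apply/setP => a; rewrite !inE.
  rewrite !cC -(leq_add2l #|[set a | v' a == None]|) cardsC.
  by rewrite -(cardsC [set a | v a == None]) leq_add2r.
have [f [fT finj]] := exists_inj_in leT.
have {}fT a : v a = None -> v' (f a) = None.
  by move=> va; apply/eqP; move: (fT a); rewrite !inE va eqxx; apply.
(* A partial permutation matrix between the radicals; its cross terms with [p] vanish because [p]
   has no entries in radical rows. *)
pose N : 'M[A]_n := \matrix_(c, a) ((v a == None) && (c == f a))%:R.
have gN : graded v' v N.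
  apply/gradedP => c a vca; rewrite mxE; case: eqP => //= va; case: eqP => // cE.
  by case: vca; rewrite cE va fT.
have GN : G' *m N = N.
  apply/matrixP => c a; rewrite mxE (bigD1 (f a)) //= big1 ?addr0; last first.
    by move=> d df; rewrite mxE (negPf df) andbF mulr0.
  rewrite !mxE eqxx andbT; case: eqP => /= va; last by rewrite mulr0.
  rewrite mulr1; case: (v' c =P None) => [/G'0->//|vc]; rewrite gG' ?fT //.
  by case: eqP vc => // ->; rewrite fT.
have NG : ctr star N *m G' = ctr star N.
  apply/matrixP => a c; rewrite mxE (bigD1 (f a)) //= big1 ?addr0; last first.
    by move=> d df; rewrite ctrE mxE (negPf df) andbF rmorph0 mul0r.
  rewrite !ctrE !mxE eqxx andbT !rmorph_nat; case: eqP => /= va; last by rewrite mul0r.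
  by rewrite mul1r G'0 ?fT // eq_sym.
have pN : ctr star p *m N = 0.
  apply/matrixP => a b; rewrite mxE [RHS]mxE big1 // => c _; rewrite ctrE mxE.
  case: eqP => /= vb; last by rewrite mulr0.
  case: eqP => [->|_]; last by rewrite mulr0.
  case va: (v a) => [i|]; last by rewrite p0 // rmorph0 mul0r.
  by move/gradedP: gp => ->; rewrite ?rmorph0 ?mul0r // va fT.
have Np : ctr star N *m p = 0 by rewrite -[p](ctrK star) -ctrM pN ctr0.
have NN : ctr star N *m N = diagv v (fun o => (o == None)%:R).
  apply/matrixP => a b; rewrite mxE (bigD1 (f a)) //= big1 ?addr0; last first.
    by move=> d df; rewrite ctrE mxE (negPf df) andbF rmorph0 mul0r.
  rewrite ctrE !mxE eqxx andbT rmorph_nat.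
  case: eqP => /= va; last by rewrite mul0r mul0rn.
  rewrite mul1r; case: (a =P b) => [<-|ab]; first by rewrite va !eqxx.
  case: eqP => //= vb; case: eqP => // fab; case: ab.
  by apply: finj fab; rewrite inE ?va ?vb.
have E0 : ctr star (p + N) *m G' *m (p + N)
    = ctr star p *m G' *m p + diagv v (fun o => (o == None)%:R).
  rewrite ctrD mulmxDl NG mulmxDl !mulmxDr Np NN add0r -[X in _ + X + _]mulmxA GN pN.
  by rewrite addr0.
by exists (p + N); rewrite E0; split=> //; apply: gradedD.
Qed.

Lemma isometry_lift :
    ctr star G = diagv v twist *m G -> ctr star G' = diagv v' twist *m G' ->
  exists p : 'M[A]_n, p \in unitmx /\
    ctr star p *m (diagv v' (pow_opt y) *m G') *m p = diagv v (pow_opt y) *m G.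
Proof.
move=> GD G'D; have [p [gp uG1 cong]] := congruent_isometry.
have [_ uG gG _] := hE; have [_ _ gG' _] := hE'.
set G1 := _ *m p in uG1 cong.
have gG1 : graded v v G1.
  by apply: (gradedM _ gp); apply: (gradedM _ gG'); apply: graded_ctr.
have G1D : ctr star G1 = diagv v twist *m G1.
  rewrite /G1 !ctrM ctrK G'D [in LHS]mulmxA [in LHS]mulmxA -(graded_ctr star gp).
  by rewrite !mulmxA.
pose X := invmx G1 *m G.
have gX : graded v v X by apply: (gradedM _ gG); apply: graded_invmx.
have X1 : exists R, X = 1%:M + y *: R.
  have [a b|R RE] := (mx_divP y 1 (G - G1)).1.
    rewrite expr1; apply/(maxideal_divP yP).
    have -> : (G - G1) a b = - (G1 a b - G a b) by rewrite mxE [X in _ + X]mxE opprB.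
    by rewrite rpredN cong.
  exists (invmx G1 *m R); rewrite scalemxAr -[y]expr1 -RE mulmxBr mulVmx //.
  by rewrite addrC subrK.
(* Both sides equal [G]: after multiplication by the twist, the left one becomes the adjoint of
   [G1 X = G]. *)
have XG : ctr star X *m G1 = G1 *m X.
  have uD : diagv v twist \in unitmx.
    rewrite unitmxE det_diag rpred_prod // => a _; rewrite mxE.
    by apply/unitrP; exists (twist (v a)); rewrite twist2.
  rewrite [RHS]mulKVmx //; apply: (can_inj (mulKmx uD)).
  by rewrite mulmxA (graded_ctr star gX) -mulmxA -G1D -ctrM mulKVmx.
have [Q [QX QG Qcomm]] := sqrt_mx yP A_complete two_unit star_y X1 XG.
have gQ : graded v v Q by move=> d; apply: Qcomm; apply: gX.
exists (p *m Q); split.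
  have uX : X \in unitmx by rewrite unitmx_mul unitmx_inv uG1.
  move: uG1 uX; rewrite -QX !unitmx_mul => /andP[_ ->].
  by case/andP.
(* Gradedness of [p] carries the powers of [y] from [v'] to [v]; gradedness of [Q] then moves them
   outside. *)
have -> : ctr star (p *m Q) *m (diagv v' (pow_opt y) *m G') *m (p *m Q)
   = ctr star Q *m (diagv v (pow_opt y) *m G1) *m Q.
  rewrite /G1 ctrM -!mulmxA; congr (_ *m _).
  by rewrite !mulmxA (graded_ctr star gp).
clearbody G1; rewrite mulmxA -(graded_ctr star gQ) -!mulmxA; congr (_ *m _).
by rewrite mulmxA QG -mulmxA QX mulKVmx.
Qed.

End Lift.
End Assembly.

(** * Gram matrices *)

Section Gram.
Variables (A : dvrType) (star : involutive_rmorphism A) (eps : A) (V : vectType A).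
Import VectorInternalTheory.

(** The columns of [P] form the new basis, written in the fixed basis of [V], whose coordinates are
    rows; hence the transpose. *)
Definition vec_of (P : 'M[A]_(dim V)) (x : 'cV[A]_(dim V)) : V := r2v (P *m x)^T.

Lemma vec_of_linear P : linear (vec_of P).
Proof. by move=> a x z; rewrite /vec_of mulmxDr -scalemxAr !linearP. Qed.

HB.instance Definition _ P := GRing.isLinear.Build A _ _ _ (vec_of P) (vec_of_linear P).

Definition coord_of (P : 'M[A]_(dim V)) (u : V) : 'cV[A]_(dim V) :=
  invmx P *m (v2r u)^T.

Lemma coord_of_linear P : linear (coord_of P).
Proof. by move=> a u v; rewrite /coord_of linearP linearP mulmxDr -scalemxAr. Qed.

HB.instance Definition _ P :=
  GRing.isLinear.Build A _ _ _ (coord_of P) (coord_of_linear P).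

Lemma vec_ofK P : P \in unitmx -> cancel (vec_of P) (coord_of P).
Proof. by move=> uP x; rewrite /coord_of /vec_of r2vK trmxK mulKmx. Qed.

Lemma coord_ofK P : P \in unitmx -> cancel (coord_of P) (vec_of P).
Proof. by move=> uP u; rewrite /coord_of /vec_of mulKVmx // trmxK v2rK. Qed.

Definition gram (h : herm_form star eps V) : 'M[A]_(dim V) :=
  \matrix_(a, b) h (r2v (delta_mx 0 a)) (r2v (delta_mx 0 b)).

Lemma gram_herm h : gram h = eps *: ctr star (gram h).
Proof. by apply/matrixP => a b; rewrite !mxE herm_sym. Qed.

Lemma herm_sumr (h : herm_form star eps V) u n (x : 'I_n -> A) (e : 'I_n -> V) :
  h u (\sum_a x a *: e a) = \sum_a x a * h u (e a).
Proof.
have h0 : h u 0 = 0 by rewrite -[0 in LHS](scale0r 0) herm_scaler mul0r.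
rewrite (big_morph _ (herm_addr h u) h0).
by apply: eq_bigr => a _; rewrite herm_scaler.
Qed.

Lemma herm_suml (h : herm_form star eps V) u n (x : 'I_n -> A) (e : 'I_n -> V) :
  h (\sum_a x a *: e a) u = \sum_a star (x a) * h (e a) u.
Proof.
rewrite herm_sym herm_sumr rmorph_sum mulr_sumr; apply: eq_bigr => a _.
by rewrite rmorphM mulrCA -herm_sym.
Qed.

Lemma gramE (h : herm_form star eps V) P x z :
  h (vec_of P x) (vec_of P z) = (ctr star x *m (ctr star P *m gram h *m P *m z)) 0 0.
Proof.
have vecE w : vec_of P w = \sum_a (P *m w) a 0 *: r2v (delta_mx 0 a).
  rewrite /vec_of {1}(row_sum_delta (P *m w)^T) linear_sum.
  by apply: eq_bigr => a _; rewrite linearZ mxE.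
rewrite -!mulmxA mulmxA -ctrM !vecE herm_suml mxE; apply: eq_bigr => a _.
rewrite ctrE herm_sumr; congr (_ * _); rewrite [RHS]mxE.
by apply: eq_bigr => b _; rewrite [gram h a b]mxE mulrC.
Qed.

Lemma equivalent_gram (h h' : herm_form star eps V) (P : 'M[A]_(dim V)) :
  P \in unitmx -> ctr star P *m gram h' *m P = gram h -> equivalent h h'.
Proof.
move=> uP PE.
pose phi : {linear V -> V} := vec_of P \o coord_of 1%:M.
exists phi => [|u v].
  by exists (vec_of 1%:M \o coord_of P) => u;
    rewrite /= ?vec_ofK ?coord_ofK ?unitmx1.
rewrite /= gramE PE -{1}[u](coord_ofK (unitmx1 _ _)) -{1}[v](coord_ofK (unitmx1 _ _)).
by rewrite gramE ctr1 mul1mx mulmx1.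
Qed.

Lemma jordan_gram y (h : herm_form star eps V) v G P :
  jordan y star (gram h) v G P -> jordan_coord y h v G (vec_of P).
Proof.
move=> [uP uG gG _ PE]; split=> // [u | x z].
  by exists (coord_of P u); rewrite /= coord_ofK.
by rewrite gramE PE !mulmxA.
Qed.

End Gram.

(** * The action of the involution on the uniformiser, and the conclusion *)

(** The sign [s] treats trivial and nontrivial involutions together: it is -1 when [star] moves some
    element and 1 otherwise. *)
Lemma star_uniformiser (A : dvrType) (star : involutive_rmorphism A) (y : A) :
    ((exists a : A, star a <> a) -> star y = - y) ->
  exists s, s * s = 1 /\ star y = s * y.
Proof.
move=> y_star; have [/y_star yN|star1] := pselect (exists a : A, star a <> a).
  by exists (-1); rewrite mulrNN mulr1 mulN1r.
exists 1; rewrite !mul1r; split=> //.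
by apply: contrapT => yN; apply: star1; exists y.
Qed.

Theorem theorem4 (A : dvrType) (A_complete : complete_dvr A)
  (two_unit : (2%:R : A) \is a GRing.unit)
  (star : involutive_rmorphism A)
  (y : A) (y_unif : uniformiser y)
  (y_star : (exists a : A, star a <> a) -> star y = - y)
  (V : vectType A) (m : nat) (rank_V : dim V = m) (m_gt0 : (0 < m)%N)
  (eps : A) (eps_sign : eps = 1 \/ eps = -1)
  (h h' : herm_form star eps V) :
  (forall i : nat, equivalent (hres h y i) (hres h' y i)) ->
  equivalent h h'.
Proof.
move=> hh'.
have [s [s2 star_y]] := star_uniformiser y_star.
have eps2 : eps * eps = 1 by case: eps_sign => ->; rewrite ?mulrNN mulr1.
have [v [G [P J]]] := jordan_exists y_unif A_complete star_y (gram_herm h).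
have [v' [G' [P' J']]] := jordan_exists y_unif A_complete star_y (gram_herm h').
have GD := jordan_herm y_unif star_y s2 eps2 (gram_herm h) J.
have G'D := jordan_herm y_unif star_y s2 eps2 (gram_herm h') J'.
have [_ _ _ G0 PE] := J; have [_ _ _ G'0 P'E] := J'.
have [p] := isometry_lift y_unif A_complete two_unit star_y s2 eps2
  (jordan_gram J) (jordan_gram J') G0 G'0 hh' GD G'D.
rewrite -P'E -PE => -[up pE]; have [uP _ _ _ _] := J; have [uP' _ _ _ _] := J'.
(* Pass to Jordan coordinates of [h], apply [p], and return through the Jordan basis of [h']. *)
apply: (equivalent_gram (P := P' *m p *m invmx P)).
  by rewrite !unitmx_mul uP' up unitmx_inv.
have -> : ctr star (P' *m p *m invmx P) *m gram h' *m (P' *m p *m invmx P)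
   = ctr star (invmx P) *m
     (ctr star p *m (ctr star P' *m gram h' *m P') *m p) *m invmx P.
  by rewrite !ctrM !mulmxA.
by rewrite pE !mulmxA -ctrM mulmxV // ctr1 mul1mx -mulmxA mulmxV // mulmx1.
Qed.
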